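(* Let $S_3=\langle d_1,d_2,d_3\rangle$ be a non-symmetric numerical semigroup minimally generated by three elements, and let $\varkappa_0,\varkappa_1,\varkappa_2,\varkappa_3$ be its rescaled coefficients. Then $$\left(10\varkappa_3-18\varkappa_1^2+\varkappa_0^2-\frac1{24}\right)\left(3\varkappa_1-2\varkappa_0^2+\frac14\right)=\left(6\varkappa_2-6\varkappa_0\varkappa_1+\frac{\varkappa_0}{2}\right)^2 .$$
   Context: A numerical semigroup $S_3=\langle d_1,d_2,d_3\rangle$ is the additive submonoid of $\mathbb{Z}_{\ge 0}$ minimally generated by positive integers $d_1,d_2,d_3$ with $\gcd(d_1,d_2,d_3)=1$; with $F=\max(\mathbb{Z}\setminus S_3)$ it is symmetric if for every integer $s$ exactly one of $s$, $F-s$ lies in $S_3$, and non-symmetric otherwise. For non-symmetric $S_3$ the Hilbert series has the form $$\sum_{s\in S_3}z^s=\frac{1-(z^{x_1}+z^{x_2}+z^{x_3})+z^{y_1}+z^{y_2}}{(1-z^{d_1})(1-z^{d_2})(1-z^{d_3})}$$ with positive integers $x_j,y_j$ (the degrees of syzygies). Put $\pi_3=d_1d_2d_3$. For $p\ge0$ define $K_p$ by $$y_1^{p+3}+y_2^{p+3}-x_1^{p+3}-x_2^{p+3}-x_3^{p+3}=\frac{(p+3)!}{p!}\,\pi_3K_p,$$ and $\varkappa_p=K_p\,\pi_3^{-(p+1)/2}$. (Known identities: $y_1+y_2=x_1+x_2+x_3$ and $y_1^2+y_2^2=x_1^2+x_2^2+x_3^2+2\pi_3$.) Equivalently, with $G_r=\sum_{s\in\mathbb{Z}_{>0}\setminus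 S_3}s^r$, $\sigma_k=d_1^k+d_2^k+d_3^k$ and $\delta_k=(\sigma_k-1)/2^k$, one has $K_0=G_0+\delta_1$, $K_1=G_1+\frac{\sigma_1}{2}G_0+\frac{3\delta_1^2+\delta_2}{6}$, $K_2=G_2+\sigma_1G_1+\frac{3\sigma_1^2+\sigma_2}{12}G_0+\frac{\delta_1(\delta_1^2+\delta_2)}{3}$, $K_3=G_3+\frac32\sigma_1G_2+\frac{3\sigma_1^2+\sigma_2}{4}G_1+\frac{\sigma_1(\sigma_1^2+\sigma_2)}{8}G_0+\frac{15\delta_1^4+30\delta_1^2\delta_2+5\delta_2^2-2\delta_4}{60}$. *)

(* Defs.v *)
From HB Require Import structures.
From mathcomp Require Import all_boot all_order all_algebra.
From mathcomp Require Import all_classical all_reals all_analysis.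

Set Implicit Arguments.
Unset Strict Implicit.
Unset Printing Implicit Defensive.

Import Order.TTheory GRing.Theory Num.Theory.
Import numFieldNormedType.Exports.

Local Open Scope classical_set_scope.
Local Open Scope ring_scope.

Definition is_submonoid (S : set nat) : Prop :=
  S 0%N /\ forall s t, S s -> S t -> S (s + t)%N.

Definition generated (D : set nat) : set nat := smallest is_submonoid D.

(* The family d is indexed, so this also forces the generators to be
   pairwise distinct. *)
Definition minimal_generators (n : nat) (d : 'I_n -> nat) : Prop :=
  forall I : set 'I_n, generated (d @` I) = generated (range d) -> I = setT.

Definition numerical_generators (n : nat) (d : 'I_n -> nat) : Prop :=
  [/\ forall i, (0 < d i)%N,
      (\big[gcdn/0]_(i < n) d i)%N = 1%N
    & minimal_generators d].

Definition intset (S : set nat) : set int := Posz @` S.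

(* F = max (Z \ S); F = -1 when S is all of nat. *)
Definition is_frobenius (S : set nat) (F : int) : Prop :=
  (~` intset S) F /\ ubound (~` intset S) F.

Definition symmetric_semigroup (S : set nat) : Prop :=
  exists F : int, is_frobenius S F /\
    forall s : int, (intset S s /\ ~ intset S (F - s)) \/
                    (~ intset S s /\ intset S (F - s)).

(* x and y are the degrees of the syzygies of <d 0, d 1, d 2>: the Hilbert
   series, as a convergent series on |z| < 1, has the rational form whose
   numerator is 1 - \sum_i z ^ x_i + \sum_j z ^ y_j. *)
Definition syzygy_degrees (R : realType)
    (d x : 'I_3 -> nat) (y : 'I_2 -> nat) : Prop :=
  [/\ forall i, (0 < x i)%N,
      forall j, (0 < y j)%N
    & forall z : R, `|z| < 1 ->
        series (fun s : nat => \1_(generated (range d)) s * z ^+ s) @ \oo -->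
          (1 - \sum_(i < 3) z ^+ x i + \sum_(j < 2) z ^+ y j)
            / \prod_(i < 3) (1 - z ^+ d i)].

Definition pi3 (d : 'I_3 -> nat) : nat := (\prod_(i < 3) d i)%N.

(* K_p, solved from
   \sum_j y_j ^ (p+3) - \sum_i x_i ^ (p+3) = (p+3)! / p! * pi3 * K_p. *)
Definition Kcoef (R : realType) (d x : 'I_3 -> nat) (y : 'I_2 -> nat)
    (p : nat) : R :=
  (\sum_(j < 2) (y j)%:R ^+ p.+3 - \sum_(i < 3) (x i)%:R ^+ p.+3)
    / ((p.+3)`!%:R / p`!%:R * (pi3 d)%:R).

Definition kappa (R : realType) (d x : 'I_3 -> nat) (y : 'I_2 -> nat)
    (p : nat) : R :=
  Kcoef R d x y p * (pi3 d)%:R `^ (- (p.+1%:R / 2)).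

(* Main.v *)
(** By the Hilbert series, the numerator [1 - \sum_i z ^ x_i + \sum_j z ^ y_j]
    is [(1 - z) ^ 2] times a polynomial with value [pi3 d] at [1], because the
    semigroup misses only finitely many integers. Hence
    [\sum_j y_j = \sum_i x_i] and
    [\sum_j y_j ^ 2 = \sum_i x_i ^ 2 + 2 * pi3 d].

    The coefficients [h_n] of
    [\prod_i (1 - x_i t) / \prod_j (1 - y_j t)] satisfy a linear recurrence of
    order 2 from [h_2] on, as there are two factors below and three above, so
    the Hankel determinant of [h_2, ..., h_6] vanishes. Newton's formulas
    express the [h_n] through the differences of power sums
    [\sum_j y_j ^ n - \sum_i x_i ^ n], that is, through the [kappa_p], with
    [h_1 = 0] and [h_2 = pi3 d]; the identity is the condensed form
    [(h2 h4 - h3^2) (h2 h6 - h4^2) = (h2 h5 - h3 h4)^2] of this determinant. *)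
Require Import Defs.
From HB Require Import structures.
From mathcomp Require Import all_boot all_order all_algebra.
From mathcomp Require Import all_classical all_reals all_analysis.
From mathcomp Require Import ring zify.

Set Implicit Arguments.
Unset Strict Implicit.

Import Order.TTheory GRing.Theory Num.Theory.
Import numFieldNormedType.Exports.

Local Open Scope classical_set_scope.
Local Open Scope ring_scope.

(** * Finiteness of the set of gaps *)

Lemma generated_submonoid (D : set nat) : is_submonoid (generated D).
Proof.
split=> [M [[M0 _] _] //|s t Ss St M MD].
by have [[_ addM] _] := MD; apply: addM; [exact: Ss | exact: St].
Qed.

Lemma submonoid_mul (S : set nat) (k s : nat) :
  is_submonoid S -> S s -> S (k * s)%N.
Proof.
by move=> [S0 addS] Ss; elim: k => [//|k IHk]; rewrite mulSn; apply: addS.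
Qed.

(** Bezout in the form [k * m = gcdn m n + a * n] stays inside [nat]: the gap [m] is used [k] times
    upwards, the gap [n] is used [a] times downwards. *)
Lemma submonoid_gap_gcd (S : set nat) (m n : nat) : is_submonoid S ->
  (exists2 s, S s & S (s + m)%N) -> (exists2 t, S t & S (t + n)%N) ->
  exists2 u, S u & S (u + gcdn m n)%N.
Proof.
move=> monS [s Ss Ssm] [t St Stn]; have [_ addS] := monS.
have [->|m_gt0] := posnP m; first by rewrite gcd0n; exists t.
have [a _ /dvdnP[k Ek]] := Bezoutl n m_gt0.
exists (k * s + a * (t + n))%N; first by apply: addS; exact: submonoid_mul.
have -> : (k * s + a * (t + n) + gcdn m n = k * (s + m) + a * t)%N.
  by rewrite !mulnDr -Ek; lia.
by apply: addS; exact: submonoid_mul.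
Qed.

Lemma submonoid_consecutive_cofinite (S : set nat) (s : nat) :
  is_submonoid S -> S s -> S s.+1 ->
  forall n, (s * s <= n)%N -> S n.
Proof.
move=> monS Ss Ss1 n le_n; have [_ addS] := monS.
have [s0|s_gt0] := posnP s.
  by rewrite -[n]muln1; apply: submonoid_mul => //; rewrite s0 in Ss1.
have le_rq : (n %% s <= n %/ s)%N.
  by rewrite (leq_trans (ltnW (ltn_pmod n s_gt0))) // leq_divRL.
(* With [n = q * s + r] and [r <= q], trade [r] of the [q] copies of [s] for copies of [s.+1]. *)
have -> : n = ((n %/ s - n %% s) * s + n %% s * s.+1)%N.
  by rewrite mulnS addnCA -mulnDl subnK // addnC -divn_eq.
by apply: addS; exact: submonoid_mul.
Qed.

Lemma generated_cofinite (n : nat) (d : 'I_n -> nat) :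
  (\big[gcdn/0]_(i < n) d i)%N = 1%N ->
  exists N, forall s, (N <= s)%N -> generated (range d) s.
Proof.
set S := generated _ => gcd_d.
have monS : is_submonoid S by exact: generated_submonoid.
have [S0 _] := monS.
suff [s Ss Ss1] : exists2 s, S s & S (s + 1)%N.
  exists (s * s)%N; apply: submonoid_consecutive_cofinite => //.
  by rewrite -addn1.
rewrite -gcd_d.
(* Differences of elements of [S] include each generator and are closed under gcd, so [1] is one of
   them. *)
apply: (big_ind (fun g => exists2 s, S s & S (s + g)%N)).
- by exists 0%N.
- by move=> a b; exact: submonoid_gap_gcd.
move=> i _; exists 0%N => //; rewrite add0n.
by apply: sub_gen_smallest; exists i.
Qed.

(** * Order of vanishing of the Hilbert numerator at 1 *)

Lemma poly_eq_on_unit_disc (R : realType) (p q : {poly R}) :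
  (forall z : R, `|z| < 1 -> p.[z] = q.[z]) -> p = q.
Proof.
move=> eq_pq; apply/eqP; rewrite -subr_eq0.
(* The points 1/2, 1/3, ... lie in the disc and outnumber the degree of [p - q]. *)
pose rs : seq R := [seq k.+2%:R^-1 | k <- iota 0 (size (p - q))].
apply/eqP/(@roots_geq_poly_eq0 _ _ rs); last by rewrite size_map size_iota.
  apply/allP => _ /mapP[k _ ->]; apply/rootP; rewrite hornerD hornerN eq_pq ?subrr//.
  by rewrite ger0_norm ?invr_ge0 ?ler0n // invf_lt1 ?ltr0n ?ltr1n.
rewrite map_inj_uniq ?iota_uniq // => k l /invr_inj/eqP.
by rewrite eqr_nat => /eqP[].
Qed.

Section HilbertSeries.
Variables (R : realType) (S : set nat) (N : nat).
Hypothesis cofS : forall s, (N <= s)%N -> S s.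

(** By [cofS], this is the generating polynomial of all the gaps of [S]. *)
Let gap_poly : {poly R} := \poly_(s < N) (1 - \1_S s).

Lemma cvg_hilbert_series (z : R) : `|z| < 1 ->
  series (fun s : nat => \1_S s * z ^+ s) @ \oo --> (1 - z)^-1 - gap_poly.[z].
Proof.
move=> z_lt1; have := @cvg_geometric_series R 1 z z_lt1; rewrite div1r => cvg_geo.
have -> : series (fun s : nat => \1_S s * z ^+ s) =
    (fun n => series (geometric 1 z) n - \sum_(s < n) (1 - \1_S s) * z ^+ s).
  apply/funext => n; rewrite /series /= !big_mkord -sumrB; apply: eq_bigr => s _.
  by rewrite /geometric /=; ring.
apply: cvgB => //; apply: cvg_near_cst; exists N => // n /= le_Nn.
rewrite horner_poly -!(big_mkord xpredT (fun s => (1 - \1_S s) * z ^+ s)).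
rewrite (@big_cat_nat _ _ _ N) //= addrC big_nat_cond big1 ?add0r // => s.
move=> /andP[/andP[le_Ns _] _].
by rewrite indicE mem_set ?subrr ?mul0r //; exact: cofS.
Qed.

(** The denominator vanishes to order [n.+2] at 1 and the series has only a simple pole there,
    coming from [(1 - z)^-1]. *)
Lemma hilbert_numerator_root_at_1 (n : nat) (d : 'I_n.+2 -> nat) (p : {poly R}) :
    (forall i, (0 < d i)%N) ->
    (forall z : R, `|z| < 1 ->
      series (fun s : nat => \1_S s * z ^+ s) @ \oo -->
        p.[z] / \prod_i (1 - z ^+ d i)) ->
  exists2 u : {poly R}, p = ('X - 1) ^+ n.+1 * u
     & u.[1] = (-1) ^+ n.+1 * (\prod_i d i)%:R.
Proof.
move=> d_gt0 cvg_p.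
pose T : {poly R} := \prod_i \sum_(j < d i) 'X^j.
have TE : \prod_i (1 - 'X^(d i)) = (1 - 'X) ^+ n.+2 * T.
  rewrite -[n.+2 in RHS]card_ord -prodr_const -big_split /=; apply: eq_bigr => i _.
  by rewrite -opprB subrX1 -mulNr opprB.
exists ((-1) ^+ n.+1 * (T * (1 - (1 - 'X) * gap_poly))); last first.
  rewrite !(hornerM, horner_exp, hornerN, hornerC, hornerD, hornerX).
  rewrite subrr mul0r subr0 mulr1 /T horner_prod.
  rewrite natr_prod; congr (_ * _); apply: eq_bigr => i _.
  rewrite horner_sum (eq_bigr (fun=> 1)) ?sumr_const ?card_ord // => j _.
  by rewrite hornerXn expr1n.
rewrite mulrA -exprMn mulrN1 opprB; apply: poly_eq_on_unit_disc => z z_lt1.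
have z1 : 1 - z != 0 by rewrite subr_eq0 gt_eqF // (le_lt_trans (ler_norm z)).
have := cvg_unique _ (cvg_p z z_lt1) (cvg_hilbert_series z_lt1).
move=> /(_ (@norm_hausdorff _ _)) /= E.
have denE : \prod_i (1 - z ^+ d i) = (1 - z) ^+ n.+2 * T.[z].
  transitivity (\prod_i (1 - 'X^(d i) : {poly R})).[z].
    by rewrite horner_prod; apply: eq_bigr => i _; rewrite !hornerE.
  by rewrite TE !hornerE.
have den0 : \prod_i (1 - z ^+ d i) != 0.
  apply/prodf_neq0 => i _; rewrite subr_eq0 gt_eqF //.
  rewrite (le_lt_trans (ler_norm _)) // normrX exprn_ilt1 //.
  by rewrite -lt0n.
rewrite -[p.[z]](divfK den0) E denE.
rewrite !(hornerM, horner_exp, hornerN, hornerC, hornerD, hornerX) exprS.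
by field.
Qed.

End HilbertSeries.

(** * Power sums of the syzygy degrees *)

Lemma syzygy_degrees_power_sums (R : realType) (d x : 'I_3 -> nat) (y : 'I_2 -> nat) :
    numerical_generators d -> syzygy_degrees R d x y ->
  \sum_j (y j)%:R = \sum_i (x i)%:R :> R /\
  \sum_j (y j)%:R ^+ 2 = \sum_i (x i)%:R ^+ 2 + 2 * (pi3 d)%:R :> R.
Proof.
move=> [d_gt0 gcd_d _] [_ _ cvg_S].
have [N cofS] := generated_cofinite gcd_d.
pose p : {poly R} := 1 - \sum_i 'X^(x i) + \sum_j 'X^(y j).
have pz z : p.[z] = 1 - \sum_i z ^+ x i + \sum_j z ^+ y j.
  rewrite /p !(hornerD, hornerN, hornerC, horner_sum).
  by congr (_ - _ + _); apply: eq_bigr => i _; rewrite hornerXn.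
have [|u pE u1] := @hilbert_numerator_root_at_1 R _ N cofS 1 d p d_gt0.
  by move=> z; rewrite pz; apply: cvg_S.
have dsum n (F : 'I_n -> {poly R}) : (\sum_i F i)^`() = \sum_i (F i)^`().
  exact: raddf_sum.
have dX n : ('X^n : {poly R})^`().[1] = n%:R.
  by rewrite derivXn hornerMn hornerXn expr1n.
have ddX n : ('X^n : {poly R})^`()^`().[1] = n%:R ^+ 2 - n%:R.
  rewrite derivXn derivMn derivXn !hornerMn hornerXn expr1n.
  case: n => [|n] /=; first by rewrite mulr0n expr0n subrr.
  by rewrite -mulr_natr -[n.+1%:R]natr1; ring.
have dp : p^`().[1] = \sum_j (y j)%:R - \sum_i (x i)%:R.
  rewrite /p !(derivD, derivN, derivC, dsum) !(hornerD, hornerN, horner_sum).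
  rewrite hornerC sub0r addrC.
  by congr (_ - _); apply: eq_bigr => i _; rewrite dX.
have ddp : p^`()^`().[1] =
    \sum_j ((y j)%:R ^+ 2 - (y j)%:R) - \sum_i ((x i)%:R ^+ 2 - (x i)%:R).
  rewrite /p !(derivD, derivN, derivC, dsum) !(hornerD, hornerN, horner_sum).
  rewrite hornerC sub0r addrC.
  by congr (_ - _); apply: eq_bigr => i _; rewrite ddX.
(* Since [p = ('X - 1) ^+ 2 * u], its first derivative vanishes at 1 and its second is [2 *
   u.[1]]. *)
have dp0 : p^`().[1] = 0.
  rewrite pE expr2 !derivM !(derivB, derivC, derivX).
  by rewrite !(hornerM, hornerD, hornerN, hornerC, hornerX); ring.
have ddp2 : p^`()^`().[1] = 2 * (pi3 d)%:R.
  have -> : (pi3 d)%:R = u.[1] by rewrite u1 sqrrN expr1n mul1r.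
  rewrite pE expr2 !(derivM, derivD, derivN, derivC, derivX).
  by rewrite !(hornerM, hornerD, hornerN, hornerC, hornerX); ring.
have sum1 : \sum_j (y j)%:R = \sum_i (x i)%:R :> R.
  by apply/eqP; rewrite -subr_eq0 -dp dp0.
split=> //; move: ddp; rewrite ddp2 !sumrB sum1 => ->; ring.
Qed.

(** The [h_n] are the coefficients of [exp (\sum_n P n / n * t ^ n)] when [P 1 = 0]. The difference
    of the two sides is [h2] times the Hankel determinant. *)
Lemma hankel_power_sums (F : numFieldType) (a b c u v : F)
    (P := fun n => u ^+ n + v ^+ n - (a ^+ n + b ^+ n + c ^+ n)) :
    P 1%N = 0 ->
  let h2 := P 2%N / 2 in
  let h3 := P 3%N / 3 in
  let h4 := P 4%N / 4 + P 2%N ^+ 2 / 8 in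
  let h5 := P 5%N / 5 + P 2%N * P 3%N / 6 in
  let h6 := P 6%N / 6 + P 2%N * P 4%N / 8 + P 3%N ^+ 2 / 18 + P 2%N ^+ 3 / 48 in
  (h2 * h4 - h3 ^+ 2) * (h2 * h6 - h4 ^+ 2) = (h2 * h5 - h3 * h4) ^+ 2.
Proof.
move=> P1 /=; have uE : u = a + b + c - v.
  by rewrite -[RHS]addr0 -P1 /P !expr1; ring.
by rewrite /P uE; field.
Qed.

Unset Implicit Arguments.

Theorem mainTheorem7 (R : realType) (d x : 'I_3 -> nat) (y : 'I_2 -> nat)
    (hd : numerical_generators d)
    (hns : ~ symmetric_semigroup (generated (range d)))
    (hxy : syzygy_degrees R d x y) :
  let k := kappa R d x y in
  (10 * k 3%N - 18 * k 1%N ^+ 2 + k 0%N ^+ 2 - 1 / 24)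
    * (3 * k 1%N - 2 * k 0%N ^+ 2 + 1 / 4)
  = (6 * k 2%N - 6 * k 0%N * k 1%N + k 0%N / 2) ^+ 2.
Proof.
move=> k; have [sum1 sum2] := syzygy_degrees_power_sums hd hxy.
have pi_gt0 : 0 < (pi3 d)%:R :> R.
  by rewrite ltr0n prodn_gt0 //; case: hd.
pose s : R := Num.sqrt (pi3 d)%:R.
have s2 : s ^+ 2 = (pi3 d)%:R by rewrite sqr_sqrtr // ltW.
have s0 : s != 0 by rewrite gt_eqF // sqrtr_gt0.
pose P n : R := (y ord0)%:R ^+ n + (y (lift ord0 ord0))%:R ^+ n
  - ((x ord0)%:R ^+ n + (x (lift ord0 ord0))%:R ^+ n
     + (x (lift ord0 (lift ord0 ord0)))%:R ^+ n).
have PE n : \sum_(j < 2) (y j)%:R ^+ n - \sum_(i < 3) (x i)%:R ^+ n = P n :> R.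
  by rewrite !big_ord_recl !big_ord0 /P; ring.
(* Writing [pi3 d] as [s ^+ 2] turns the half-integer powers in [kappa] into integer powers of
   [s]. *)
have kE p : P p.+3 = (p.+3)`!%:R / p`!%:R * s ^+ p.+3 * k p.
  have fact0 m : m`!%:R != 0 :> R by rewrite pnatr_eq0 -lt0n fact_gt0.
  rewrite /k /kappa /Kcoef PE powRN [p.+1%:R / 2]mulrC powRrM.
  rewrite powR12_sqrt ?ltW // powR_mulrn ?sqrtr_ge0 // -/s -s2 !exprS.
  by field; rewrite expf_neq0 ?s0 ?fact0.
have P1 : P 1%N = 0.
  rewrite -PE; under eq_bigr do rewrite expr1.
  by under [X in _ - X]eq_bigr do rewrite expr1; rewrite sum1 subrr.
have P2 : P 2%N = 2 * s ^+ 2 by rewrite -PE sum2 s2; ring.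
have := hankel_power_sums P1; rewrite -!/(P _) P2 !kE /=.
rewrite !factS fact0 => hankel.
(* Each [h_n] carries [s ^+ n]; the three Hankel minors are [2 * s ^+ 6], [2 * s ^+ 8] and
   [2 * s ^+ 7] times the factors of the goal. *)
have c0 : 4 * s ^+ 14 != 0 by rewrite mulf_neq0 ?expf_neq0 ?pnatr_eq0.
apply: (mulfI c0).
by apply: (etrans _ (etrans hankel _)); field.
Qed.
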